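(* Let $k\ge 2$ be an integer and $c_k := 4\cos^2\frac{\pi}{k+1}$. (i) For every real $c$ with $1\le c<c_k$ there exists a $k\times k$ Toeplitz matrix $M\in TP_2(c)$ with $\det M<0$. (ii) For every real $c$ with $1\le c<c_k$ there exists a $k\times k$ Hankel matrix $M\in TP_2(c)$ with $\det M<0$.
   Context: For $c\ge 1$, $TP_2(c)$ denotes the class of all real matrices $M=(a_{i,j})$ with positive entries such that $a_{i,j}a_{i+1,j+1}\ge c\, a_{i,j+1}a_{i+1,j}$ for all $i,j$ (for which these entries exist). A matrix is Toeplitz if it is of the form $(a_{j-i})$, and Hankel if it is of the form $(a_{j+i})$. *)

(* Defs.v *)
From mathcomp Require Import all_boot all_order all_algebra.
From mathcomp Require Import all_classical all_reals all_analysis.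

Set Implicit Arguments.
Unset Strict Implicit.
Unset Printing Implicit Defensive.

Import Order.TTheory GRing.Theory Num.Theory.

Local Open Scope ring_scope.

(* The indices i', j' stand for i + 1, j + 1,
   so the inequality is required exactly when the four entries exist. *)
Definition TP2 (R : realType) (m n : nat) (c : R) (M : 'M[R]_(m, n)) : Prop :=
  (forall i j, 0 < M i j) /\
  (forall (i i' : 'I_m) (j j' : 'I_n),
     i' = i.+1 :> nat -> j' = j.+1 :> nat ->
     M i j * M i' j' >= c * M i j' * M i' j).

Definition toeplitz (R : Type) (m n : nat) (M : 'M[R]_(m, n)) : Prop :=
  exists a : int -> R, forall (i : 'I_m) (j : 'I_n), M i j = a (j%:Z - i%:Z).

(* Rows and columns are numbered from 0; shifting the sequence a recovers
   the 1-based indexing. *)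
Definition hankel (R : Type) (m n : nat) (M : 'M[R]_(m, n)) : Prop :=
  exists a : nat -> R, forall (i : 'I_m) (j : 'I_n), M i j = a (j + i)%N.

Definition cK (R : realType) (k : nat) : R := 4 * cos (pi / k.+1%:R) ^+ 2.

(* Main.v *)
Require Import Defs.
From mathcomp Require Import all_boot all_order all_algebra.
From mathcomp Require Import all_classical all_reals all_analysis.
From mathcomp Require Import zify ring lra.
Import Order.TTheory GRing.Theory Num.Theory.
Import numFieldNormedType.Exports.
Local Open Scope ring_scope.

(** Both parts come from one symmetric Toeplitz matrix, [sym_toeplitz] applied
    to the sequence
      t_d = beta_d e^f(d),   f(d) = floor(d^2/4),
      beta_d = b for d even, 1 for d odd,
    with b = 2 cos x, x slightly larger than pi/(k+1), and e > 0 tiny.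

    Sign of the determinant.  At e = 0 only the diagonal b and its two
    neighbours, equal to 1, survive.  The determinant of this tridiagonal
    matrix is the Chebyshev value sin((k+1)x)/sin x ([sin_det_tridiag]),
    negative when pi < (k+1)x < 2pi.  The determinant is a polynomial in e
    ([horner_det_band]), hence still negative for small e > 0.

    Total positivity.  The second difference of f is 1 at odd d and 0 at
    positive even d, so the ratio t_d^2 / (t_(d-1) t_(d+1)) is 1/(b^2 e) at odd
    d and b^2 at even d ([band_seq_log_concave]; at d = 0 this is the ratio
    t_0^2 / t_1^2).  The first is large, and the second exceeds c because
    4 cos(x)^2 tends to c_k > c as x decreases to pi/(k+1)
    ([band_parameters]).  Hence the Toeplitz matrix is in TP_2(c).

    Hankel case.  The inverse of a log-concave sequence is log-convex, so the
    Hankel matrix with entries b / t_(i+j+1) is in TP_2(c) too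
    ([TP2_hankel_inv]).  Since
      C(i+1,2) + C(j+1,2) = f(i+j+1) + f(|i-j|)
    ([quarter_squareD]) and i+j+1, |i-j| have opposite parities,
    t_(i+j+1) t_|i-j| is b times a product of a function of i and a function
    of j.  So this Hankel matrix is D T D with T the Toeplitz matrix and D a
    positive diagonal matrix ([hankel_band_congruence]), and its determinant
    has the same sign. *)

(** This is floor(d^2/4). *)
Definition quarter_square (d : nat) : nat := (d./2 * uphalf d)%N.

Lemma quarter_square_convex (d : nat) :
  (quarter_square d + quarter_square d.+2 =
   2 * quarter_square d.+1 + ~~ odd d)%N.
Proof.
rewrite /quarter_square /= !uphalf_half /=.
by case: (odd d) => /=; nia.
Qed.

Lemma quarter_squareE (d : nat) : (4 * quarter_square d + odd d = d ^ 2)%N.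
Proof.
rewrite /quarter_square uphalf_half -[in RHS](odd_double_half d) -muln2.
by case: (odd d) => /=; nia.
Qed.

(** With s = i + j + 1 and d = |i - j|, twice the left side is
    i(i+1) + j(j+1) = (s^2 + d^2 - 1)/2, and exactly one of s, d is odd, which
    is the 1 lost in rounding down s^2/4 and d^2/4. *)
Lemma quarter_squareD (i j : nat) :
  ('C(i.+1, 2) + 'C(j.+1, 2) =
   quarter_square (i + j).+1 + quarter_square ((i - j) + (j - i)))%N.
Proof.
have binE m : (2 * 'C(m.+1, 2) = m * m.+1)%N.
  by rewrite mul2n bin2 halfK /= oddM /= andNb subn0 mulnC.
wlog le_ij : i j / (i <= j)%N.
  move=> IH; have [/IH //|/ltnW le_ji] := leqP i j.
  by rewrite addnC IH // (addnC j i) (addnC (j - i)%N).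
rewrite (eqP le_ij) add0n -(subnKC le_ij); move: (j - i)%N => d.
rewrite (addKn i d).
have := quarter_squareE (i + (i + d)).+1; have := quarter_squareE d.
have := binE i; have := binE (i + d)%N.
rewrite /= !oddD addbA addbb /=.
by case: (odd d) => /=; nia.
Qed.

Definition band_seq {R : pzRingType} (b e : R) (d : nat) : R :=
  (if odd d then 1 else b) * e ^+ quarter_square d.

Lemma band_seq_gt0 (R : realType) (b e : R) (d : nat) : 0 < b -> 0 < e ->
  0 < band_seq b e d.
Proof. by move=> b_gt0 e_gt0; rewrite mulr_gt0 ?exprn_gt0 //; case: ifP. Qed.

(** By [quarter_square_convex], t_d t_(d+2) / t_(d+1)^2 is b^2 e for even d,
    whence the third hypothesis, and 1 / b^2 for odd d, whence the second. *)
Lemma band_seq_log_concave (R : realType) (b c e : R) (d : nat) :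
  0 < e -> c <= b ^+ 2 -> c * b ^+ 2 * e <= 1 ->
  c * (band_seq b e d * band_seq b e d.+2) <= band_seq b e d.+1 ^+ 2.
Proof.
move=> e_gt0 cb cbe; rewrite /band_seq /= negbK.
set f := quarter_square.
have -> : c * ((if odd d then 1 else b) * e ^+ f d *
              ((if odd d then 1 else b) * e ^+ f d.+2)) =
          c * (if odd d then 1 else b) ^+ 2 * e ^+ (~~ odd d) *
          (e ^+ f d.+1) ^+ 2.
  rewrite mulrACA -exprD quarter_square_convex exprD mulnC exprM expr2.
  by rewrite /f; ring.
rewrite exprMn ler_wpM2r ?exprn_ge0 ?(ltW e_gt0) //.
by case: (odd d); rewrite /= ?expr1n ?mulr1.
Qed.

(** In truncated subtraction the index (i - j) + (j - i) is |i - j|. *)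
Definition sym_toeplitz {R : Type} (t : nat -> R) (n : nat) : 'M[R]_n :=
  \matrix_(i, j) t ((i - j) + (j - i))%N.

(** Laplace expansion along the first row: the second minor has first column
    (1, 0, ..., 0). *)
Lemma det_sym_toeplitz_tridiag (R : comNzRingType) (t : nat -> R) (n : nat) :
  t 1%N = 1 -> (forall d, t d.+2 = 0) ->
  \det (sym_toeplitz t n.+2) =
  t 0%N * \det (sym_toeplitz t n.+1) - \det (sym_toeplitz t n).
Proof.
move=> t1 t2.
rewrite (expand_det_row _ ord0) !big_ord_recl big1 => [|j _]; last first.
  by rewrite mxE /= t2 mul0r.
rewrite !mxE /= addr0 t1 mul1r; congr (_ * _ + _).
  rewrite /cofactor expr0 mul1r; congr (\det _).
  by apply/matrixP => i j; rewrite !mxE.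
rewrite /cofactor /= expr1 mulN1r; congr (- _).
rewrite (expand_det_col _ ord0) big_ord_recl big1 => [|i _]; last first.
  by rewrite !mxE /= t2 mul0r.
rewrite !mxE /= t1 mul1r addr0 /cofactor expr0 mul1r; congr (\det _).
by apply/matrixP => i j; rewrite !mxE.
Qed.

(** Both sides satisfy u_(n+2) = 2 cos x u_(n+1) - u_n.  Multiplying by sin x
    avoids the singular values of the usual quotient. *)
Lemma sin_det_tridiag (R : realType) (t : nat -> R) (x : R) (n : nat) :
  t 0%N = 2 * cos x -> t 1%N = 1 -> (forall d, t d.+2 = 0) ->
  sin x * \det (sym_toeplitz t n) = sin (n.+1%:R * x).
Proof.
move=> t0 t1 t2.
elim/ltn_ind: n => -[_|[_|n IHn]].
- by rewrite det_mx00 mulr1 mul1r.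
- rewrite (expand_det_row _ ord0) big_ord_recl big_ord0 addr0.
  rewrite /cofactor det_mx00 mxE subnn addn0 t0 expr0 !mulr1.
  by rewrite (mulr_natl x) mulr2n sinD; ring.
rewrite det_sym_toeplitz_tridiag // t0 mulrBr.
rewrite (IHn n) // mulrCA (IHn n.+1) //.
have -> : n.+3%:R * x = n.+2%:R * x + x by rewrite -natr1; ring.
have -> : n.+1%:R * x = n.+2%:R * x - x by rewrite -(natr1 n.+1); ring.
by rewrite !sinD sinN cosN; ring.
Qed.

(** Computing the determinant over {poly R} with e replaced by the variable
    makes its continuity in e immediate. *)
Lemma horner_det_band (R : comNzRingType) (b : R) (n : nat) :
  exists p : {poly R}, forall e, \det (sym_toeplitz (band_seq b e) n) = p.[e].
Proof.
exists (\det (sym_toeplitz (band_seq b%:P 'X) n)) => e.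
rewrite -horner_evalE -det_map_mx; congr (\det _).
apply/matrixP => i j; rewrite !mxE /band_seq rmorphM rmorphXn /=.
by rewrite /horner_eval hornerX; case: ifP; rewrite hornerC.
Qed.

Lemma TP2_sym_toeplitz (R : realType) (c : R) (t : nat -> R) (n : nat) :
  (forall d, 0 < t d) -> c * t 1%N ^+ 2 <= t 0%N ^+ 2 ->
  (forall d, c * (t d * t d.+2) <= t d.+1 ^+ 2) ->
  TP2 c (sym_toeplitz t n).
Proof.
move=> t_gt0 t01 tlc; split=> [i j|i i' j j' ii' jj']; first by rewrite mxE.
rewrite !mxE ii' jj' !subSS -mulrA -expr2.
have [ij|ji|ij] := ltngtP i j.
- have -> : (i - j.+1 + (j.+1 - i) = (j - i).-1.+2)%N by lia.
  have -> : (i.+1 - j + (j - i.+1) = (j - i).-1)%N by lia.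
  have -> : (i - j + (j - i) = (j - i).-1.+1)%N by lia.
  by rewrite [X in c * X]mulrC.
- have -> : (i - j.+1 + (j.+1 - i) = (i - j).-1)%N by lia.
  have -> : (i.+1 - j + (j - i.+1) = (i - j).-1.+2)%N by lia.
  have -> : (i - j + (j - i) = (i - j).-1.+1)%N by lia.
  exact: tlc.
- have -> : (i - j.+1 + (j.+1 - i) = 1)%N by lia.
  have -> : (i.+1 - j + (j - i.+1) = 1)%N by lia.
  by have -> : (i - j + (j - i) = 0)%N by lia.
Qed.

(** The index is shifted by one because [quarter_squareD] pairs |i - j| with
    i + j + 1. *)
Definition hankel_inv {R : realType} (b : R) (t : nat -> R) (n : nat) :
    'M[R]_n :=
  \matrix_(i, j) (b / t (i + j).+1).

Lemma TP2_hankel_inv (R : realType) (b c : R) (t : nat -> R) (n : nat) :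
  0 < b -> (forall d, 0 < t d) ->
  (forall d, c * (t d * t d.+2) <= t d.+1 ^+ 2) ->
  TP2 c (hankel_inv b t n).
Proof.
move=> b_gt0 t_gt0 tlc; split=> [i j|i i' j j' ii' jj'].
  by rewrite mxE divr_gt0.
rewrite !mxE ii' jj' !addnS !addSn; set d := (i + j)%N.
have := tlc d.+1.
have := t_gt0 d.+1; have := t_gt0 d.+2; have := t_gt0 d.+3.
move: (t d.+1) (t d.+2) (t d.+3) => u v w.
move=> w0 v0 u0 uvw.
have -> : c * (b / v) * (b / v) = b ^+ 2 * (c / v ^+ 2).
  by field; rewrite gt_eqF.
have -> : b / u * (b / w) = b ^+ 2 * (1 / (u * w)).
  by field; rewrite !gt_eqF.
rewrite ler_wpM2l ?sqr_ge0 // ler_pdivrMr ?exprn_gt0 // mulrAC.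
by rewrite ler_pdivlMr ?mulr_gt0 // mul1r.
Qed.

(** Entrywise, b / t_(i+j+1) = D_i t_|i-j| D_j: the parity factors of
    t_(i+j+1) and t_|i-j| multiply to b since i + j + 1 and |i - j| have
    opposite parities, and [quarter_squareD] splits the exponents of e. *)
Lemma hankel_band_congruence (R : realType) (b e : R) (n : nat) :
  0 < b -> 0 < e ->
  let D := \row_(i < n) e ^- 'C(i.+1, 2) in
  hankel_inv b (band_seq b e) n =
    diag_mx D *m sym_toeplitz (band_seq b e) n *m diag_mx D.
Proof.
move=> b_gt0 e_gt0 D; apply/matrixP => i j.
rewrite mul_mx_diag mul_diag_mx !mxE.
have e_neq0 m : e ^+ m != 0 by rewrite expf_neq0 ?gt_eqF.
have := e_neq0 'C(i.+1, 2); have := e_neq0 'C(j.+1, 2).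
have : e ^+ 'C(i.+1, 2) * e ^+ 'C(j.+1, 2) * b =
    band_seq b e (i + j).+1 * band_seq b e ((i - j) + (j - i)).
  rewrite -exprD quarter_squareD exprD /band_seq.
  have -> : odd (i + j).+1 = ~~ odd (i - j + (j - i)) by lia.
  by case: (odd _) => /=; ring.
have := @band_seq_gt0 R b e (i + j).+1 b_gt0 e_gt0.
move: (band_seq _ _ _) (band_seq _ _ _) (e ^+ _) (e ^+ _) => u v x y.
move=> u_gt0 xyb y0 x0; have u0 := lt0r_neq0 u_gt0.
apply: (mulIf u0); rewrite divfK //.
apply: (mulfI (mulf_neq0 x0 y0)); rewrite xyb.
by field; rewrite x0 y0.
Qed.

Lemma det_hankel_band_lt0 (R : realType) (b e : R) (n : nat) :
  0 < b -> 0 < e ->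
  \det (sym_toeplitz (band_seq b e) n) < 0 ->
  \det (hankel_inv b (band_seq b e) n) < 0.
Proof.
move=> b_gt0 e_gt0 det_lt0.
rewrite hankel_band_congruence // !det_mulmx det_diag mulrAC.
rewrite pmulr_rlt0 // mulr_gt0 // prodr_gt0 // => i _;
  by rewrite mxE invr_gt0 exprn_gt0.
Qed.

(** b = 2 cos x with x just above x0 = pi/(k+1): staying below 2 x0 keeps
    (k+1)x in the range (pi, 2pi) where its sine is negative, and k >= 2 keeps
    2 x0 below pi, where sin x > 0. *)
Lemma tridiag_parameter (R : realType) (k : nat) (c : R) : (2 <= k)%N ->
  1 <= c -> c < cK R k ->
  exists b, [/\ 0 < b, c <= b ^+ 2 & \det (sym_toeplitz (band_seq b 0) k) < 0].
Proof.
move=> k_ge2 c_ge1 c_lt; have pi_gt0 := pi_gt0 R.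
have k1_gt0 : 0 < k.+1%:R :> R by rewrite ltr0n.
pose x0 : R := pi / k.+1%:R.
have x0_gt0 : 0 < x0 by rewrite divr_gt0.
have k3 : 3 <= k.+1%:R :> R by rewrite ler_nat.
have x0_lt : 2 * x0 < pi.
  by rewrite /x0 mulrA ltr_pdivrMr // mulrC ltr_pM2l //; lra.
have cos_x0 : 0 < cos x0 by rewrite cos_gt0_pihalf //; apply/andP; split; lra.
have [x [x_gt x_lt cos_x cx]] :
    exists x, [/\ x0 < x, x < 2 * x0, 0 < cos x & c < 4 * cos x ^+ 2].
  near (at_right x0) => x; exists x; split.
  - by near: x; exact: nbhs_right_gt.
  - by near: x; apply: nbhs_right_lt; lra.
  - near: x; apply: (@cvgr_gt _ _ _ _ cos (cos x0)) => //.
    by apply: cvg_at_right_filter; exact: continuous_cos.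
  - near: x; apply: (@cvgr_gt _ _ _ _ _ (4 * cos x0 ^+ 2)) => //.
    apply: cvg_at_right_filter; apply: cvgM; first exact: cvg_cst.
    by apply: cvgM; exact: continuous_cos.
exists (2 * cos x); split; [lra | by rewrite exprMn -natrX ltW |].
have sin_x : 0 < sin x by apply: sin_gt0_pi; apply/andP; split; lra.
rewrite -(pmulr_rlt0 _ sin_x) sin_det_tridiag; first last.
- by move=> d; rewrite /band_seq expr0n /= mulr0.
- by rewrite /band_seq mul1r.
- by rewrite /band_seq mulr1.
have -> : k.+1%:R * x = (k.+1%:R * x - pi) + pi by ring.
rewrite sinDpi oppr_lt0 sin_gt0_pi //.
have kx0 : k.+1%:R * x0 = pi by rewrite /x0 mulrC divfK ?gt_eqF.
have : k.+1%:R * x0 < k.+1%:R * x by rewrite ltr_pM2l.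
have : k.+1%:R * x < k.+1%:R * (2 * x0) by rewrite ltr_pM2l.
by rewrite mulrCA kx0 => *; apply/andP; split; lra.
Unshelve. all: by end_near. Qed.

Lemma band_parameters (R : realType) (k : nat) (c : R) : (2 <= k)%N ->
  1 <= c -> c < cK R k ->
  exists b e, [/\ 0 < b, 0 < e, c <= b ^+ 2, c * b ^+ 2 * e <= 1 &
    \det (sym_toeplitz (band_seq b e) k) < 0].
Proof.
move=> k_ge2 c_ge1 c_lt.
have [b [b_gt0 cb det0]] := @tridiag_parameter R k c k_ge2 c_ge1 c_lt.
have cb2_gt0 : 0 < c * b ^+ 2 by rewrite mulr_gt0 ?exprn_gt0; lra.
have [p detE] := @horner_det_band R b k.
exists b; near (at_right (0 : R)) => e; exists e; split=> //.
- rewrite -ler_pdivlMl // mulr1 ltW //; near: e; apply: nbhs_right_lt.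
  by rewrite invr_gt0.
- rewrite detE; near: e; apply: (@cvgr_lt _ _ _ _ _ p.[0]);
    last by rewrite -detE.
  by apply: cvg_at_right_filter; exact: continuous_horner.
Unshelve. all: by end_near. Qed.

Theorem theorem4 (R : realType) (k : nat) (hk : (2 <= k)%N) :
  (forall c : R, 1 <= c -> c < cK R k ->
     exists M : 'M[R]_k, [/\ toeplitz M, TP2 c M & \det M < 0]) /\
  (forall c : R, 1 <= c -> c < cK R k ->
     exists M : 'M[R]_k, [/\ hankel M, TP2 c M & \det M < 0]).
Proof.
split=> c c_ge1 c_lt;
  have [b [e [b_gt0 e_gt0 cb cbe det_lt0]]] :=
    @band_parameters R k c hk c_ge1 c_lt;
  have t_gt0 d := @band_seq_gt0 R b e d b_gt0 e_gt0;
  have tlc d := @band_seq_log_concave R b c e d e_gt0 cb cbe.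
- exists (sym_toeplitz (band_seq b e) k); split=> //.
    exists (fun z => band_seq b e `|z|%N) => i j; rewrite mxE.
    by congr (band_seq b e _); lia.
  apply: TP2_sym_toeplitz => //.
  by rewrite /band_seq /quarter_square /= !mulr1 expr1n mulr1.
- exists (hankel_inv b (band_seq b e) k); split.
  + by exists (fun m => b / band_seq b e m.+1) => i j; rewrite mxE addnC.
  + exact: TP2_hankel_inv.
  + exact: det_hankel_band_lt0.
Qed.
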